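(* Let $m,r\ge 1$ and let $p_1(z_1,\ldots,z_m),\ldots,p_r(z_1,\ldots,z_m)$ be non-constant polynomials in $m$ complex variables with coefficients in $\mathbb{C}$ whose common zero set $\mathbf{Z}(p_1,\ldots,p_r)\subset\mathbb{C}^m$ is finite. Then the algebraic matrix $m$-disk $\mathbb{ZD}_n^m(p_1,\ldots,p_r)$ is uniformly piecewise differentiably path connected with respect to the metric $\eth$, uniformly in $n$. That is: for every $\varepsilon>0$ there is $\delta>0$ such that for every integer $n\ge 1$, every $\mathbf{X}\in\mathbb{ZD}_n^m(p_1,\ldots,p_r)$ and every $\mathbf{Y}\in\mathbb{ZD}_n^m(p_1,\ldots,p_r)\cap B_\eth(\mathbf{X},\delta)$, there is a piecewise $C^1$ path $\gamma\in C([0,1],\mathbb{ZD}_n^m(p_1,\ldots,p_r))$ with $\gamma(0)=\mathbf{X}$, $\gamma(1)=\mathbf{Y}$ and $\gamma(t)\in B_\eth(\mathbf{X},\varepsilon)$ for each $0\le t\le 1$.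
   Context: $M_n$ is the set of $n\times n$ complex matrices, $M_n^m$ the set of $m$-tuples of such matrices, $\|\cdot\|$ the operator norm induced by the Euclidean norm on $\mathbb{C}^n$, and $\mathbf{0}_n$ the zero matrix. The metric $\eth$ on $M_n^m$ is $\eth(\mathbf{S},\mathbf{T})=\max_{1\le j\le m}\|S_j-T_j\|$, and $B_\eth(\mathbf{X},\delta)=\{\mathbf{Y}\in M_n^m : \eth(\mathbf{X},\mathbf{Y})<\delta\}$. The common zero set is $\mathbf{Z}(p_1,\ldots,p_r)=\{\mathbf{x}\in\mathbb{C}^m : p_j(\mathbf{x})=0,\ 1\le j\le r\}$. $\mathbb{D}_n^m$ is the set of $(X_1,\ldots,X_m)\in M_n^m$ such that $X_jX_k=X_kX_j$, $X_jX_j^*=X_j^*X_j$ and $\|X_j\|\le 1$ for all $1\le j,k\le m$. The algebraic matrix $m$-disk is $\mathbb{ZD}_n^m(p_1,\ldots,p_r)=\{(X_1,\ldots,X_m)\in\mathbb{D}_n^m : p_j(X_1,\ldots,X_m)=\mathbf{0}_n,\ 1\le j\le r\}$. *)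

(* Defs.v *)
From HB Require Import structures.
From mathcomp Require Import all_boot all_order all_algebra.
From mathcomp Require Import all_classical all_reals all_analysis.
From mathcomp Require Import complex.
(* mpoly is not imported: its notations clash with those of the analysis
   library. *)
From mathcomp Require mpoly.

Set Implicit Arguments.
Unset Strict Implicit.
Unset Printing Implicit Defensive.

Import Order.TTheory GRing.Theory Num.Theory.
Import numFieldNormedType.Exports.

Local Open Scope classical_set_scope.
Local Open Scope ring_scope.
Local Open Scope complex_scope.

Definition mxtuple (R : realType) (m n : nat) := 'I_m -> 'M[R[i]]_n.

Section Tuples.
Variables (R : realType) (m n : nat).
Implicit Types (S T X Y : mxtuple R m n).

(* The library norm `|z| of z : R[i] is itself in R[i]; normc z is the same
   number as an element of R. *)
Definition vnorm (v : 'cV[R[i]]_n) : R :=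
  Num.sqrt (\sum_i Normc.normc (v i 0) ^+ 2).

Definition opnorm (A : 'M[R[i]]_n) : R :=
  sup [set vnorm (A *m v) | v in [set v | vnorm v <= 1]].

Definition eth S T : R := \big[Num.max/0]_(j < m) opnorm (S j - T j).

Definition eth_ball X (delta : R) : set (mxtuple R m n) :=
  [set Y | eth X Y < delta].

Definition mxdisk : set (mxtuple R m n) :=
  [set X | [/\ forall j k, comm_mx (X j) (X k),
               forall j, X j \is normalmx
             & forall j, opnorm (X j) <= 1]].

Definition eth_continuous (A : set R) (gamma : R -> mxtuple R m n) :=
  forall t, A t -> eth (gamma s) (gamma t) @[s --> within A (nbhs t)] --> (0 : R).

(* The derivative relative to A, hence one-sided at the endpoints when A is a
   segment. *)
Definition is_eth_deriv (A : set R) (gamma dgamma : R -> mxtuple R m n) :=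
  forall t, A t ->
    eth (fun j => ((s - t)^-1)%:C *: (gamma s j - gamma t j)) (dgamma t)
      @[s --> within A t^'] --> (0 : R).

Definition C1_on (A : set R) (gamma : R -> mxtuple R m n) :=
  exists2 dgamma, is_eth_deriv A gamma dgamma & eth_continuous A dgamma.

Definition piecewise_C1 (a b : R) (gamma : R -> mxtuple R m n) :=
  eth_continuous `[a, b] gamma /\
  exists2 s : seq R, itv_partition a b s &
    forall i, (i < size s)%N ->
      C1_on `[nth b (a :: s) i, nth b (a :: s) i.+1] gamma.

End Tuples.

Definition common_zeros (R : realType) (m r : nat)
    (p : 'I_r -> mpoly.mpoly m R[i]) : set ('I_m -> R[i]) :=
  [set x | forall j, mpoly.meval x (p j) = 0].

(* Since mmap takes values in a nontrivial ring, the matrix size is written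
   n.+1.  The order of the factors in mmap is irrelevant for the commuting
   tuples considered below. *)
Definition mxmeval (R : realType) (m n : nat) (X : mxtuple R m n.+1)
    (p : mpoly.mpoly m R[i]) : 'M[R[i]]_n.+1 :=
  mpoly.mmap (@scalar_mx _ n.+1) X p.

Definition algmxdisk (R : realType) (m r n : nat)
    (p : 'I_r -> mpoly.mpoly m R[i]) : set (mxtuple R m n.+1) :=
  [set X | mxdisk X /\ forall j, mxmeval X (p j) = 0].

Arguments algmxdisk {R m r} n p.

(* Main.v *)
(** By simultaneous unitary diagonalization, X = V^* diag(x_k) V and
    Y = W^* diag(y_l) W, where all the points x_k, y_l lie in the finite set Z of
    common zeros.  If N is obtained from M = W V^* by erasing the entries (l, k)
    with y_l <> x_k, then S = W^* N V satisfies S X_j = Y_j S and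
    S X_j^* = Y_j^* S.  The erased blocks are the E_w M F_z with w <> z in Z
    (spectral projections of the diagonals), and such a block times w_j - z_j is
    a compression of W (Y_j - X_j) V^*; hence |S - 1| <= K eth(X, Y), with
    a constant K depending only on Z and not on n.  The unitary polar part U of S is then
    close to 1 and U X_j U^* = Y_j.
    Writing U = V'^* diag(exp(i th_k)) V' and
    U(t) = V'^* diag(exp(i t th_k)) V', the path U(t) X U(t)^* joins X to Y inside
    the algebraic disk, its entries are trigonometric polynomials in t, and it
    stays within 2 |U - 1| of X since |exp(i t th) - 1| <= |exp(i th) - 1| for
    t in [0, 1] and |th| <= pi. *)

Require Import Defs.
From mathcomp Require Import all_boot all_order all_algebra.
From mathcomp Require Import all_classical all_reals all_analysis.
From mathcomp Require Import complex.
From mathcomp Require mpoly.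
From mathcomp Require Import ring lra.

Set Implicit Arguments.
Unset Strict Implicit.
Unset Printing Implicit Defensive.

Import Order.TTheory GRing.Theory Num.Theory.
Import numFieldNormedType.Exports.

Local Open Scope classical_set_scope.
Local Open Scope ring_scope.
Local Open Scope complex_scope.
Local Open Scope sesquilinear_scope.

(** * Unitary diagonalization of normal matrices *)

Section UnitaryDiagonalization.
Variables (C : numClosedFieldType) (n : nat).
Implicit Types (A B E F M N S U V W X Y : 'M[C]_n) (d e f : 'rV[C]_n).

(** For unitary [V], the rows of [V] are left eigenvectors and the columns of [V^t*] right
    eigenvectors, with eigenvalues the entries of [d]. *)
Definition udiag V d := V^t* *m diag_mx d *m V.

Lemma unitarymxKl V : V \is unitarymx -> V^t* *m V = 1%:M.
Proof. by move/unitarymxP/mulmx1C. Qed.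

Lemma udiagM V d e : V \is unitarymx ->
  udiag V d *m udiag V e = udiag V (\row_i (d 0 i * e 0 i)).
Proof.
move=> uV; rewrite /udiag !mulmxA mulmxtVK // -[_ *m diag_mx d *m _]mulmxA.
by rewrite mulmx_diag.
Qed.

Lemma adjmxM A B : (A *m B)^t* = B^t* *m A^t*.
Proof. by rewrite trmx_mul map_mxM. Qed.

Lemma unitarymx_adj V : V \is unitarymx -> V^t* \is unitarymx.
Proof. by rewrite trmxC_unitary. Qed.

Lemma unitarymx_polar S A : A^t* *m (S^t* *m S) *m A = 1%:M ->
  S *m A \is unitarymx.
Proof.
move=> SA; rewrite -trmxC_unitary; apply/unitarymxP.
by rewrite trmxCK adjmxM -SA !mulmxA.
Qed.

(** The two intertwining relations make [X] commute with [S^t* *m S], hence with [A]; then S A X = S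
    X A = Y S A. Here [A] stands for the inverse square root of [S^t* *m S]. *)
Lemma polar_intertwines S A X Y : S *m A \is unitarymx ->
  S *m X = Y *m S -> S *m X^t* = Y^t* *m S ->
  (comm_mx X (S^t* *m S) -> comm_mx X A) ->
  S *m A *m X *m (S *m A)^t* = Y.
Proof.
move=> uSA SX SXa XA; have SYa : S^t* *m Y = X *m S^t*.
  by rewrite -[Y]trmxCK -[X]trmxCK -!adjmxM SXa.
have {}XA : comm_mx X A.
  by apply: XA; rewrite /comm_mx mulmxA -SYa -!mulmxA SX.
by rewrite -[S *m A *m X]mulmxA -XA mulmxA SX -[Y *m S *m A]mulmxA mulmxtVK.
Qed.

Lemma udiag_adj V d : (udiag V d)^t* = udiag V (map_mx Num.conj d).
Proof.
by rewrite /udiag !trmx_mul !map_mxM trmxCK tr_diag_mx map_diag_mx mulmxA.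
Qed.

Lemma udiag_const V c : V \is unitarymx -> udiag V (const_mx c) = c%:M.
Proof.
move=> uV; rewrite /udiag diag_const_mx scalar_mxC -mulmxA unitarymxKl //.
by rewrite mulmx1.
Qed.

Lemma udiagM3 V d e f : V \is unitarymx ->
  udiag V d *m udiag V e *m udiag V f =
  udiag V (\row_i (d 0 i * e 0 i * f 0 i)).
Proof.
move=> uV; rewrite !udiagM //.
by congr udiag; apply/rowP => i; rewrite !mxE.
Qed.

Lemma udiagB V d e : udiag V d - udiag V e = udiag V (d - e).
Proof. by rewrite /udiag -mulmxBl -mulmxBr [diag_mx (d - e)]linearB. Qed.

Lemma udiagE V d : V \is unitarymx -> diag_mx d = V *m udiag V d *m V^t*.
Proof.
move=> uV; rewrite /udiag !mulmxA mulmxtVK // (unitarymxP uV).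
by rewrite mul1mx.
Qed.

Lemma udiag_unitaryP V d : V \is unitarymx ->
  reflect (forall i, Num.conj (d 0 i) * d 0 i = 1) (udiag V d \is unitarymx).
Proof.
move=> uV; have dE : (udiag V d \is unitarymx) =
    (udiag V (\row_i (Num.conj (d 0 i) * d 0 i)) == udiag V (const_mx 1)).
  rewrite qualifE /= udiag_adj udiagM // udiag_const //.
  by congr (udiag V _ == _); apply/rowP => i; rewrite !mxE mulrC.
rewrite dE; apply: (iffP eqP) => [/(congr1 (fun M => V *m M *m V^t*))|d1].
  by rewrite -!udiagE // => /matrixP h i; have := h i i; rewrite !mxE eqxx.
by congr udiag; apply/rowP => i; rewrite !mxE d1.
Qed.

Lemma udiag_mul_mx V A d e :
  udiag V d *m A *m udiag V e =
  V^t* *m (\matrix_(k, l) (d 0 k * (V *m A *m V^t*) k l * e 0 l)) *m V.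
Proof.
have -> : \matrix_(k, l) (d 0 k * (V *m A *m V^t*) k l * e 0 l) =
    diag_mx d *m (V *m A *m V^t*) *m diag_mx e.
  move: (V *m A *m V^t*) => B; rewrite mul_mx_diag mul_diag_mx.
  by apply/matrixP => k l; rewrite !mxE.
by rewrite /udiag !mulmxA.
Qed.

Lemma mul_conjmx U A B : U \is unitarymx ->
  U *m A *m U^t* *m (U *m B *m U^t*) = U *m (A *m B) *m U^t*.
Proof. by move=> uU; rewrite !mulmxA mulmxKtV. Qed.

Lemma adj_conjmx U A : (U *m A *m U^t*)^t* = U *m A^t* *m U^t*.
Proof. by rewrite !adjmxM trmxCK mulmxA. Qed.

Lemma comm_conjmx U A B : U \is unitarymx -> comm_mx A B ->
  comm_mx (U *m A *m U^t*) (U *m B *m U^t*).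
Proof. by move=> uU AB; rewrite /comm_mx !mul_conjmx // AB. Qed.

Lemma normal_conjmx U A : U \is unitarymx -> A \is normalmx ->
  U *m A *m U^t* \is normalmx.
Proof.
move=> uU /normalmxP An; apply/normalmxP.
by rewrite adj_conjmx !mul_conjmx // An.
Qed.

(** [E] turns [A] into the scalar [a] from the left, and [F] turns [B] into [b] from the right. When
    [a] and [b] differ, this recovers the block of [M] from the defect of intertwining. *)
Lemma sylvester_block A B E F M (a b : C) :
  E *m A = a *: E -> B *m F = b *: F ->
  (a - b) *: (E *m M *m F) = E *m (A *m M - M *m B) *m F.
Proof.
move=> EA BF; rewrite mulmxBr mulmxBl !mulmxA EA -[E *m M *m B *m F]mulmxA BF.
by rewrite scalerBl -scalemxAr -!scalemxAl.
Qed.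

Lemma sylvester_udiag V W d e : V \is unitarymx -> W \is unitarymx ->
  W *m (udiag W e - udiag V d) *m V^t* =
  diag_mx e *m (W *m V^t*) - W *m V^t* *m diag_mx d.
Proof.
move=> uV uW; rewrite mulmxBr mulmxBl /udiag !mulmxA mulmxtVK //.
by rewrite (unitarymxP uW) mul1mx.
Qed.

(** In the two eigenbases the sides have entries [N i k * d 0 k] and [e 0 i * N i k]: both vanish
    with [N i k] and agree otherwise. *)
Lemma intertwine_udiag V W N d e : V \is unitarymx -> W \is unitarymx ->
  (forall i k, N i k != 0 -> e 0 i = d 0 k) ->
  (W^t* *m N *m V) *m udiag V d = udiag W e *m (W^t* *m N *m V).
Proof.
move=> uV uW ed; rewrite /udiag !mulmxA !mulmxtVK //; congr (_ *m _).
rewrite -!mulmxA; congr (_ *m _); rewrite mul_mx_diag mul_diag_mx.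
apply/matrixP => i k; rewrite !mxE; have [->|N0] := eqVneq (N i k) 0.
  by rewrite mulr0 mul0r.
by rewrite (ed _ _ N0) mulrC.
Qed.

(** In the same pair of bases the identity is represented by [W *m V^t*]. *)
Lemma intertwine_sub1 V W N : V \is unitarymx -> W \is unitarymx ->
  W^t* *m N *m V - 1%:M = W^t* *m (N - W *m V^t*) *m V.
Proof.
move=> uV uW; rewrite mulmxBr mulmxBl; congr (_ - _).
by rewrite mulmxA unitarymxKl // mul1mx unitarymxKl.
Qed.

Lemma normal_udiag A : A \is normalmx ->
  exists V d, V \is unitarymx /\ A = udiag V d.
Proof.
move=> /orthomx_spectralP AE; exists (spectralmx A), (spectral_diag A).
have uV := spectral_unitarymx A.
by split=> //; rewrite [LHS]AE invmx_unitary.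
Qed.

(** The hypothesis on [d] and [e] says that [udiag V e] is a function of [udiag V d]. In the
    eigenbasis, a matrix commuting with [udiag V d] has zero entries wherever the eigenvalues
    differ, so it commutes with every such function. *)
Lemma comm_udiag B V d e : V \is unitarymx ->
  (forall i j, d 0 i = d 0 j -> e 0 i = e 0 j) ->
  comm_mx B (udiag V d) -> comm_mx B (udiag V e).
Proof.
move=> uV de Bd; pose B' := V *m B *m V^t*.
have BE : B = V^t* *m B' *m V.
  by rewrite /B' !mulmxA unitarymxKl // mul1mx mulmxKtV.
have B'd : diag_mx d *m B' = B' *m diag_mx d.
  move: (udiagE d uV) Bd; move: (udiag V d) => A -> Bd.
  by rewrite /B' !mulmxA !mulmxKtV // -[V *m A *m B]mulmxA -Bd !mulmxA.
clearbody B'.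
have B'e : diag_mx e *m B' = B' *m diag_mx e.
  rewrite mul_diag_mx mul_mx_diag; apply/matrixP => i j; rewrite !mxE.
  move/matrixP: B'd => /(_ i j).
  rewrite mul_diag_mx mul_mx_diag !mxE.
  have [->|B0] := eqVneq (B' i j) 0; first by rewrite !(mulr0, mul0r).
  rewrite mulrC => /(mulfI B0)/de ->. by rewrite mulrC.
rewrite /comm_mx {1 2}BE /udiag !mulmxA.
rewrite ![_ *m V *m V^t*]mulmxtVK // -![V^t* *m _ *m _]mulmxA.
by rewrite B'e.
Qed.

(** The adjoint of a normal matrix is a function of it: its eigenvalues are the conjugates, in the
    same eigenbasis. *)
Lemma fuglede A B : A \is normalmx -> comm_mx B A -> comm_mx B (A^t*).
Proof.
move=> /normal_udiag[V [d [uV ->]]]; rewrite udiag_adj; apply: comm_udiag => //.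
by move=> i j; rewrite !mxE => ->.
Qed.

Lemma simultaneous_udiag (m : nat) (X : 'I_m -> 'M[C]_n) :
  (forall j k, comm_mx (X j) (X k)) -> (forall j, X j \is normalmx) ->
  exists V (ds : 'I_m -> 'rV[C]_n),
    V \is unitarymx /\ forall j, X j = udiag V (ds j).
Proof.
(* The adjoints join the family, which still commutes by [fuglede]; one unitary then triangularizes
   every matrix together with its adjoint. *)
move=> Xc Xn; pose Xs := [seq X j | j : 'I_m] ++ [seq (X j)^t* | j : 'I_m].
have adjM (A B : 'M[C]_n) : comm_mx A B -> comm_mx (A^t*) (B^t*).
  by move=> AB; rewrite /comm_mx -!map_mxM -!trmx_mul AB.
have Xsc : {in Xs &, forall A B, comm_mx A B}.
  move=> A B; rewrite !mem_cat.
  move=> /orP[]/mapP[j _ ->] /orP[]/mapP[k _ ->] //.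
  - exact: fuglede.
  - by apply: comm_mx_sym; apply: fuglede.
  - exact: adjM.
have [P uP /allP /= PX] := cotrigonalization Xsc.
have D j : is_diag_mx (P *m X j *m P^t*).
  have t1 : is_trig_mx (P *m X j *m P^t*).
    rewrite -conjymx //; apply: PX; rewrite mem_cat.
    by rewrite map_f // mem_enum.
  have t2 : is_trig_mx (P *m (X j)^t* *m P^t*).
    rewrite -conjymx //; apply: PX; rewrite mem_cat.
    by rewrite [X in _ || X](map_f (fun j => (X j)^t*)) ?orbT // mem_enum.
  (* A triangular matrix whose adjoint is triangular on the same side is diagonal. *)
  rewrite is_diag_mxEtrig t1; apply/is_trig_mxP => a b ab; rewrite mxE.
  move/is_trig_mxP: t2 => /(_ a b ab).
  rewrite -{1}[P]trmxCK -!map_mxM -!trmx_mul !mulmxA 2!mxE.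
  by move/eqP; rewrite conjC_eq0 => /eqP.
have /choice[d dE] : forall j, exists d, P *m X j *m P^t* = diag_mx d.
  by move=> j; apply/diag_mxP.
exists P, d; split=> // j; rewrite /udiag -dE !mulmxA unitarymxKl // mul1mx.
by rewrite mulmxKtV.
Qed.

End UnitaryDiagonalization.

(** * Operator norm *)

Section ComplexModulus.
Variable R : realType.
Local Notation C := R[i].
Implicit Types z : C.

Lemma normcE z : (Normc.normc z)%:C = `|z|.
Proof. by case: z => a b; rewrite normc_def. Qed.

Lemma normc_ge0 z : 0 <= Normc.normc z.
Proof. by rewrite -ler0c normcE. Qed.

Lemma sqr_normcE z : (Normc.normc z ^+ 2)%:C = z^* * z.
Proof. by rewrite rmorphXn /= normcE normCKC. Qed.

End ComplexModulus.

Lemma cauchy_schwarz_sum (R : rcfType) (I : finType) (a b : I -> R) :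
  \sum_i a i * b i <=
  Num.sqrt (\sum_i a i ^+ 2) * Num.sqrt (\sum_i b i ^+ 2).
Proof.
have [lt0|ge0] := ltP (\sum_i a i * b i) 0.
  by rewrite (le_trans (ltW lt0))// mulr_ge0 ?sqrtr_ge0.
rewrite -sqrtrM; last by rewrite sumr_ge0 // => i _; exact: sqr_ge0.
rewrite -[leLHS]ger0_norm // -sqrtr_sqr ler_wsqrtr //.
(* Doubling symmetrizes the double sum: by Lagrange's identity the difference is the sum of the
   squares of [a i * b j - a j * b i]. *)
suff : (\sum_i a i * b i) ^+ 2 *+ 2 <=
       (\sum_i a i ^+ 2) * (\sum_i b i ^+ 2) *+ 2 by rewrite lerMn2r.
rewrite [X in _ <= X]mulr2n {2}[(\sum_i a i ^+ 2) * _]mulrC expr2.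
rewrite !mulr_suml -big_split -sumrMnl /= ler_sum // => i _.
rewrite !mulr_sumr -big_split -sumrMnl /= ler_sum // => j _.
rewrite -subr_ge0; have := sqr_ge0 (a i * b j - a j * b i).
by congr (0 <= _); ring.
Qed.

Section VectorNorm.
Variables (R : realType) (n : nat).
Local Notation C := R[i].
Implicit Types (u v : 'cV[C]_n).

Lemma vnorm_ge0 v : 0 <= vnorm v.
Proof. exact: sqrtr_ge0. Qed.

Lemma sqr_vnorm v : vnorm v ^+ 2 = \sum_i Normc.normc (v i 0) ^+ 2.
Proof. by rewrite sqr_sqrtr ?sumr_ge0 // => i _; rewrite sqr_ge0. Qed.

Lemma sqr_vnormE v : (vnorm v ^+ 2)%:C = (v^t* *m v) 0 0.
Proof.
rewrite sqr_vnorm rmorph_sum mxE; apply: eq_bigr => i _.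
by rewrite !mxE; exact: sqr_normcE.
Qed.

Lemma vnorm0 : vnorm (0 : 'cV[C]_n) = 0.
Proof.
rewrite /vnorm big1 ?sqrtr0 // => i _.
by rewrite mxE Normc.normc0 expr0n.
Qed.

Lemma vnorm_eq0 v : vnorm v = 0 -> v = 0.
Proof.
move=> v0; have := sqr_vnorm v; rewrite v0 expr0n => /esym/eqP.
rewrite psumr_eq0 => [/allP h|i _]; last exact: sqr_ge0.
apply/colP => i; rewrite mxE; apply: Normc.eq0_normc; apply/eqP.
by have := h i; rewrite mem_index_enum sqrf_eq0 => /(_ isT).
Qed.

Lemma vnorm_delta i : vnorm (delta_mx i 0 : 'cV[C]_n) = 1.
Proof.
rewrite /vnorm (bigD1 i) //= big1 => [|j ji].
  by rewrite !mxE !eqxx Normc.normc1 expr1n addr0 sqrtr1.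
by rewrite !mxE (negPf ji) Normc.normc0 expr0n.
Qed.

Lemma vnormZ (c : C) v : vnorm (c *: v) = Normc.normc c * vnorm v.
Proof.
rewrite -[Normc.normc c]ger0_norm ?normc_ge0 // -sqrtr_sqr -sqrtrM ?sqr_ge0 //.
rewrite mulr_sumr; congr Num.sqrt; apply: eq_bigr => i _.
by rewrite mxE Normc.normcM exprMn.
Qed.

Lemma vnormD u v : vnorm (u + v) <= vnorm u + vnorm v.
Proof.
rewrite -ler_sqr ?nnegrE ?addr_ge0 ?vnorm_ge0 // sqrrD !sqr_vnorm.
have := cauchy_schwarz_sum (fun i => Normc.normc (u i 0))
                           (fun i => Normc.normc (v i 0)).
rewrite -/(vnorm u) -/(vnorm v) -(ler_pMn2r (ltn0Sn 1)) -sumrMnl /= => h.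
rewrite addrAC -lerBlDl; apply: le_trans h.
rewrite lerBlDl -!big_split /= ler_sum // => i _.
have : Normc.normc (u i 0 + v i 0) ^+ 2 <=
       (Normc.normc (u i 0) + Normc.normc (v i 0)) ^+ 2.
  by rewrite ler_sqr ?nnegrE ?addr_ge0 ?normc_ge0 // le_normcD.
by rewrite mxE -subr_ge0 => h; rewrite -subr_ge0; congr (0 <= _): h; ring.
Qed.

Lemma vnorm_le (c : R) u v : 0 <= c ->
  (forall i, Normc.normc (u i 0) <= c * Normc.normc (v i 0)) ->
  vnorm u <= c * vnorm v.
Proof.
move=> c0 h; rewrite -ler_sqr ?nnegrE ?mulr_ge0 ?vnorm_ge0 //.
rewrite exprMn !sqr_vnorm mulr_sumr ler_sum // => i _.
by rewrite -exprMn ler_sqr ?nnegrE ?mulr_ge0 ?normc_ge0.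
Qed.

Lemma normc_le_vnorm v i : Normc.normc (v i 0) <= vnorm v.
Proof.
rewrite -ler_sqr ?nnegrE ?vnorm_ge0 ?normc_ge0 // sqr_vnorm (bigD1 i) //=.
by rewrite lerDl sumr_ge0 // => j _; rewrite sqr_ge0.
Qed.

Lemma vnorm_le_sum v : vnorm v <= \sum_i Normc.normc (v i 0).
Proof.
have s0 : 0 <= \sum_i Normc.normc (v i 0).
  by rewrite sumr_ge0 // => i _; exact: normc_ge0.
rewrite -ler_sqr ?nnegrE ?vnorm_ge0 // sqr_vnorm expr2 mulr_suml.
rewrite ler_sum // => i _; rewrite expr2 ler_wpM2l ?normc_ge0 //.
by rewrite (bigD1 i) //= lerDl sumr_ge0 // => j _; exact: normc_ge0.
Qed.

End VectorNorm.

Section OperatorNorm.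
Variables (R : realType) (n : nat).
Local Notation C := R[i].
Implicit Types (A B : 'M[C]_n) (v : 'cV[C]_n).

Lemma normc_sum (I : finType) (F : I -> C) :
  Normc.normc (\sum_i F i) <= \sum_i Normc.normc (F i).
Proof.
elim/big_ind2: _ => [|x1 x2 y1 y2 h1 h2|//]; first by rewrite Normc.normc0.
by rewrite (le_trans (le_normcD _ _)) // lerD.
Qed.

(** A crude bound that grows with the dimension. It shows that the supremum is finite and that paths
    in a fixed dimension are smooth; it never enters the choice of [delta]. *)
Definition entry_norm A : R := \sum_i \sum_j Normc.normc (A i j).

Lemma vnorm_mul_entry A v : vnorm (A *m v) <= entry_norm A * vnorm v.
Proof.
apply: le_trans (vnorm_le_sum _) _; rewrite mulr_suml ler_sum // => i _.
rewrite mxE (le_trans (normc_sum _)) // mulr_suml ler_sum // => j _.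
by rewrite Normc.normcM ler_wpM2l ?normc_ge0 // normc_le_vnorm.
Qed.

Let opset A := [set vnorm (A *m v) | v in [set v | vnorm v <= 1]].

(** [sup] is a true least upper bound only on a nonempty bounded set, so this and [opset_neq0]
    underlie all estimates of [opnorm]. *)
Lemma opset_ub A : has_ubound (opset A).
Proof.
exists (entry_norm A) => _ [v /= v1 <-].
apply: le_trans (vnorm_mul_entry _ _) _; rewrite ler_piMr //.
by do 2![rewrite sumr_ge0 // => ? _]; exact: normc_ge0.
Qed.

Lemma opset_neq0 A : opset A !=set0.
Proof. by exists (vnorm (A *m 0)), 0 => //=; rewrite vnorm0. Qed.

Lemma opnorm_ge0 A : 0 <= opnorm A.
Proof.
apply: le_trans (ub_le_sup (opset_ub A) _); last first.
  by exists 0 => //=; rewrite vnorm0.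
exact: vnorm_ge0.
Qed.

Lemma vnorm_opnorm A v : vnorm (A *m v) <= opnorm A * vnorm v.
Proof.
have [v0|v0] := eqVneq (vnorm v) 0.
  by rewrite (vnorm_eq0 v0) mulmx0 vnorm0 mulr0.
have v_gt0 : 0 < vnorm v by rewrite lt_neqAle eq_sym v0 vnorm_ge0.
rewrite -ler_pdivrMr //.
have nV : Normc.normc ((vnorm v)^-1)%:C = (vnorm v)^-1.
  by apply: complexI; rewrite normcE ger0_norm // ler0c invr_ge0 ltW.
rewrite mulrC -nV -vnormZ scalemxAr.
by apply: (ub_le_sup (opset_ub A)); exists ((vnorm v)^-1%:C *: v) => //=;
  rewrite vnormZ nV mulVf.
Qed.

Lemma normc_le_opnorm A i j : Normc.normc (A i j) <= opnorm A.
Proof.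
have -> : A i j = (A *m delta_mx j (0 : 'I_1)) i 0 by rewrite -colE mxE.
apply: le_trans (normc_le_vnorm _ _) _.
by apply: le_trans (vnorm_opnorm _ _) _; rewrite vnorm_delta mulr1.
Qed.

Lemma opnorm_le A (c : R) : 0 <= c ->
  (forall v, vnorm (A *m v) <= c * vnorm v) -> opnorm A <= c.
Proof.
move=> c0 h; apply: ge_sup; first exact: opset_neq0.
by move=> _ [v /= v1 <-]; apply: le_trans (h v) _; rewrite ler_piMr.
Qed.

Lemma opnormD A B : opnorm (A + B) <= opnorm A + opnorm B.
Proof.
apply: opnorm_le => [|v]; first by rewrite addr_ge0 ?opnorm_ge0.
by rewrite mulmxDl mulrDl (le_trans (vnormD _ _)) // lerD ?vnorm_opnorm.
Qed.

Lemma opnormM A B : opnorm (A *m B) <= opnorm A * opnorm B.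
Proof.
apply: opnorm_le => [|v]; first by rewrite mulr_ge0 ?opnorm_ge0.
rewrite -mulmxA -mulrA (le_trans (vnorm_opnorm _ _)) //.
by rewrite ler_wpM2l ?opnorm_ge0 ?vnorm_opnorm.
Qed.

Lemma opnormZ_le (c : C) A : opnorm (c *: A) <= Normc.normc c * opnorm A.
Proof.
apply: opnorm_le => [|v]; first by rewrite mulr_ge0 ?opnorm_ge0 ?normc_ge0.
by rewrite -scalemxAl vnormZ -mulrA ler_wpM2l ?normc_ge0 ?vnorm_opnorm.
Qed.

Lemma opnormN A : opnorm (- A) = opnorm A.
Proof.
have le B : opnorm (- B) <= opnorm B.
  have := opnormZ_le (-1) B.
  by rewrite scaleN1r normcN Normc.normc1 mul1r.
apply: le_anti; apply/andP; split; first exact: le.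
by have := le (- A); rewrite opprK.
Qed.

Lemma opnormB A B : opnorm (A - B) = opnorm (B - A).
Proof. by rewrite -opnormN opprB. Qed.

Lemma opnorm0 : opnorm (0 : 'M[C]_n) = 0.
Proof.
apply/eqP; rewrite eq_le opnorm_ge0 andbT; apply: opnorm_le => // v.
by rewrite mul0mx vnorm0 mul0r.
Qed.

Lemma opnorm_sum (I : Type) (s : seq I) (P : pred I) (F : I -> 'M[C]_n) :
  opnorm (\sum_(i <- s | P i) F i) <= \sum_(i <- s | P i) opnorm (F i).
Proof.
elim/big_ind2: _ => [|x1 x2 y1 y2 h1 h2|//]; first by rewrite opnorm0.
by rewrite (le_trans (opnormD _ _)) // lerD.
Qed.

Lemma opnorm_entry A : opnorm A <= entry_norm A.
Proof.
apply: opnorm_le => [|v]; last exact: vnorm_mul_entry.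
by do 2![rewrite sumr_ge0 // => ? _]; exact: normc_ge0.
Qed.

Lemma opnorm_diag (d : 'rV[C]_n) (c : R) : 0 <= c ->
  (forall i, Normc.normc (d 0 i) <= c) -> opnorm (diag_mx d) <= c.
Proof.
move=> c0 h; apply: opnorm_le => // v; apply: vnorm_le => // i.
by rewrite mul_diag_mx mxE Normc.normcM ler_wpM2r ?normc_ge0.
Qed.

Lemma vnorm_isometry A v : A^t* *m A = 1%:M -> vnorm (A *m v) = vnorm v.
Proof.
move=> AA; suff : vnorm (A *m v) ^+ 2 = vnorm v ^+ 2.
  by move/eqP; rewrite eqrXn2 ?vnorm_ge0 // => /eqP.
apply: complexI; rewrite !sqr_vnormE trmx_mul map_mxM /=.
by rewrite mulmxA -[_ *m A^t* *m A]mulmxA AA mulmx1.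
Qed.

Lemma opnorm_unitary_mul A B : A \is unitarymx ->
  opnorm (A *m B) <= opnorm B.
Proof.
move=> uA; apply: opnorm_le => [|v]; first exact: opnorm_ge0.
by rewrite -mulmxA vnorm_isometry ?unitarymxKl ?vnorm_opnorm.
Qed.

Lemma opnorm_mul_unitary A B : A \is unitarymx ->
  opnorm (B *m A) <= opnorm B.
Proof.
move=> uA; apply: opnorm_le => [|v]; first exact: opnorm_ge0.
rewrite -[X in _ * X](vnorm_isometry v (unitarymxKl uA)) -mulmxA.
exact: vnorm_opnorm.
Qed.

Lemma opnorm_conj A B : A \is unitarymx ->
  opnorm (A *m B *m A^t*) <= opnorm B.
Proof.
move=> uA; apply: le_trans (opnorm_mul_unitary _ (unitarymx_adj uA)) _.
exact: opnorm_unitary_mul.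
Qed.

(** The difference is the commutator of [B] with [A - 1%:M], multiplied by the unitary [A^t*]. *)
Lemma opnorm_conj_sub A B : A \is unitarymx ->
  opnorm (B - A *m B *m A^t*) <= 2 * (opnorm (A - 1%:M) * opnorm B).
Proof.
move=> uA; have -> : B - A *m B *m A^t* =
    (B *m (A - 1%:M) - (A - 1%:M) *m B) *m A^t*.
  rewrite mulmxBr [(A - 1%:M) *m B]mulmxBl mulmx1 mul1mx opprB addrA subrK.
  rewrite mulmxBl.
  by rewrite mulmxtVK.
apply: le_trans (opnorm_mul_unitary _ (unitarymx_adj uA)) _.
apply: le_trans (opnormD _ _) _; rewrite opnormN mulr_natl mulr2n.
by apply: lerD; first rewrite mulrC; exact: opnormM.
Qed.

End OperatorNorm.

(** * Intertwining unitaries *)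

Section Polar.
Variables (R : realType) (n : nat).
Local Notation C := R[i].
Implicit Types (A S V : 'M[C]_n) (d : 'rV[C]_n).

Lemma opnorm_udiag V d (c : R) : V \is unitarymx -> 0 <= c ->
  (forall i, Normc.normc (d 0 i) <= c) -> opnorm (udiag V d) <= c.
Proof.
move=> uV c0 dc; rewrite /udiag; apply: le_trans (opnorm_mul_unitary _ uV) _.
apply: le_trans (opnorm_unitary_mul _ _) (opnorm_diag c0 dc).
by rewrite trmxC_unitary.
Qed.

Lemma opnorm_udiag_sub1 V d (c : R) : V \is unitarymx -> 0 <= c ->
  (forall i, Normc.normc (d 0 i - 1) <= c) -> opnorm (udiag V d - 1%:M) <= c.
Proof.
move=> uV c0 dc; rewrite -(udiag_const 1 uV) udiagB opnorm_udiag // => i.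
by rewrite !mxE.
Qed.

Lemma normc_real (x : R) : Normc.normc x%:C = `|x|.
Proof. by rewrite /Normc.normc /= expr0n /= addr0 sqrtr_sqr. Qed.

(* The witness is S (S^* S)^(-1/2); the eigenvalues of S^* S are the squares of
   the norms of the S v, for v in an orthonormal eigenbasis. *)
Lemma polar_near1 S (e : R) : e <= 2^-1 -> opnorm (S - 1%:M) <= e ->
  exists A, [/\ S *m A \is unitarymx, opnorm (S *m A - 1%:M) <= 4 * e &
    forall B, comm_mx B (S^t* *m S) -> comm_mx B A].
Proof.
move=> e2 Se; have e0 := le_trans (opnorm_ge0 _) Se.
have Hn : S^t* *m S \is normalmx.
  by apply/normalmxP; rewrite trmx_mul map_mxM trmxCK.
have [V [d [uV HE]]] := normal_udiag Hn.
have sqS (v : 'cV[C]_n) :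
    (vnorm (S *m v) ^+ 2)%:C = (v^t* *m (S^t* *m S) *m v) 0 0.
  by rewrite sqr_vnormE trmx_mul map_mxM !mulmxA.
pose b i : 'cV[C]_n := V^t* *m delta_mx i 0.
pose s i := vnorm (S *m b i).
have sE i : (s i ^+ 2)%:C = d 0 i.
  rewrite sqS HE /b /udiag !trmx_mul !map_mxM trmxCK !mulmxA.
  rewrite !mulmxtVK // trmx_delta map_delta_mx -rowE -colE !mxE eqxx.
  by rewrite mulr1n.
have b1 i : vnorm (b i) = 1.
  rewrite vnorm_isometry; last by rewrite trmxCK (unitarymxP uV).
  exact: vnorm_delta.
(* [S *m b i] and the unit vector [b i] are at distance at most [e], hence so are their norms [s i]
   and 1. *)
have s1 i : `|s i - 1| <= e.
  have dv : vnorm (S *m b i - b i) <= e.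
    rewrite -[X in _ - X]mul1mx -mulmxBl (le_trans (vnorm_opnorm _ _)) //.
    by rewrite b1 mulr1.
  have dv' : vnorm (b i - S *m b i) <= e.
    by rewrite -opprB -scaleN1r vnormZ normcN Normc.normc1 mul1r.
  rewrite ler_norml lerBrDl lerBlDl; apply/andP; split.
    have := vnormD (b i - S *m b i) (S *m b i).
    rewrite subrK b1 -/(s i); move: dv'.
    by move: (vnorm (b i - _)) (s i); clear=> *; lra.
  have := vnormD (S *m b i - b i) (b i).
  rewrite subrK b1 -/(s i); move: dv.
  by move: (vnorm (_ - b i)) (s i); clear=> *; lra.
(* Here [e <= 2^-1] enters: the spectrum of [S^t* *m S] stays away from 0, and the inverse square
   root has norm at most 2. *)
have s_ge i : 2^-1 <= s i.
  by have := s1 i; rewrite ler_norml; move: (s i) e2; clear=> *; lra.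
have s_gt0 i : 0 < s i by apply: lt_le_trans (s_ge i); rewrite invr_gt0.
have sV i : (s i)^-1 <= 2.
  by rewrite -[2]invrK lef_pV2 ?posrE ?invr_gt0.
clearbody s; pose A := udiag V (\row_i (s i)^-1%:C).
have AHA : A^t* *m (S^t* *m S) *m A = 1%:M.
  rewrite HE udiag_adj udiagM3 // -(udiag_const 1 uV).
  congr udiag; apply/rowP => i; rewrite !mxE -(sE i).
  have -> : Num.conj (s i)^-1%:C = (s i)^-1%:C by exact: conjc_real.
  rewrite -!rmorphM /= -[RHS]/(1%:C); congr (_%:C).
  by have := s_gt0 i; move: (s i) => x x0; field; rewrite gt_eqF.
exists A; split.
- exact: unitarymx_polar.
- have A2 : opnorm A <= 2.
    apply: opnorm_udiag => // i.
    by rewrite mxE normc_real ger0_norm // invr_ge0 ltW.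
  have A1 : opnorm (A - 1%:M) <= 2 * e.
    apply: opnorm_udiag_sub1 => [//||i]; first by rewrite mulr_ge0.
    rewrite mxE -[1]/(1%:C) -rmorphB normc_real.
    have -> : (s i)^-1 - 1 = (s i)^-1 * (1 - s i).
      by rewrite mulrBr mulr1 mulVf // gt_eqF.
    rewrite normrM ler_pM // 1?distrC // ger0_norm // invr_ge0 ltW //.
  (* The constant 4: the first summand has norm at most [e * 2], the second at most [2 * e]. *)
  have -> : S *m A - 1%:M = (S - 1%:M) *m A + (A - 1%:M).
    by rewrite mulmxBl mul1mx addrA subrK.
  apply: le_trans (opnormD _ _) _.
  have := opnormM (S - 1%:M) A; have := opnorm_ge0 A.
  have := opnorm_ge0 (S - 1%:M).
  move: (opnorm _) (opnorm A) (opnorm _) (opnorm _) A2 A1 Se; clear=> *; nra.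
(* As [s] is positive, the eigenvalue [s i ^+ 2] determines [s i], so [A] is a function of
   [S^t* *m S]. *)
- move=> B; rewrite HE; apply: comm_udiag => // i j.
  rewrite -(sE i) -(sE j) !mxE => /complexI/eqP.
  by rewrite eqrXn2 ?ltW // => /eqP ->.
Qed.

Lemma unitary_intertwiner (m : nat) (X Y : 'I_m -> 'M[C]_n) S (e : R) :
  e <= 2^-1 -> opnorm (S - 1%:M) <= e ->
  (forall j, S *m X j = Y j *m S) ->
  (forall j, S *m (X j)^t* = (Y j)^t* *m S) ->
  exists U : 'M[C]_n, [/\ U \is unitarymx, opnorm (U - 1%:M) <= 4 * e &
    forall j, U *m X j *m U^t* = Y j].
Proof.
move=> e2 Se SX SXa; have [A [uSA SA1 Ac]] := polar_near1 e2 Se.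
exists (S *m A); split=> // j.
by apply: polar_intertwines (SX j) (SXa j) _; last exact: Ac.
Qed.

End Polar.

(** * Polynomials evaluated at matrix tuples and joint eigenvalues *)

Section MatrixEvaluation.
Variables (R : realType) (m n : nat).
Local Notation C := R[i].
Implicit Types (X : mxtuple R m n.+1) (p : mpoly.mpoly m C).

(** Conjugation by a unitary is multiplicative and fixes scalar matrices, so it passes through every
    monomial. *)
Lemma mxmeval_conj (U : 'M[C]_n.+1) X p : U \is unitarymx ->
  mxmeval (fun j => U *m X j *m U^t*) p = U *m mxmeval X p *m U^t*.
Proof.
move=> uU; pose f (A : 'M[C]_n.+1) := U *m A *m U^t*.
have fM : {morph f : A B / A * B}.
  by move=> A B; rewrite /f -!mulmxE !mulmxA mulmxKtV.
have f1 : f 1 = 1 by rewrite /f mulmx1 (unitarymxP uU).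
have fX k A : f (A ^+ k) = f A ^+ k.
  by elim: k => [|k IH]; rewrite ?expr0 // !exprS fM IH.
rewrite /mxmeval /mpoly.mmap mulmx_sumr mulmx_suml; apply: eq_bigr => k _.
rewrite -/(f _) fM; congr (_ * _).
  by rewrite /f scalar_mxC mulmxtVK.
rewrite /mpoly.mmap1 (big_morph f fM f1).
by apply: eq_bigr => j _; rewrite fX.
Qed.

Lemma eigen_mxmeval X (v : 'rV[C]_n.+1) (x : 'I_m -> C) :
  (forall j, v *m X j = x j *: v) ->
  forall p, v *m mxmeval X p = mpoly.meval x p *: v.
Proof.
move=> vX p; have vXk j k : v *m X j ^+ k = x j ^+ k *: v.
  elim: k => [|k IH]; first by rewrite !expr0 mulmx1 scale1r.
  by rewrite exprSr -mulmxE mulmxA IH -scalemxAl vX scalerA exprSr.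
rewrite mpoly.mevalE /mxmeval /mpoly.mmap mulmx_sumr scaler_suml.
apply: eq_bigr => k _; rewrite -mulmxE mulmxA mul_mx_scalar -scalemxAl.
rewrite -scalerA; congr (_ *: _); rewrite /mpoly.mmap1.
elim: (index_enum _) => [|j s IH]; first by rewrite !big_nil mulmx1 scale1r.
by rewrite !big_cons -mulmxE mulmxA vXk -scalemxAl IH scalerA.
Qed.

(** Row [i] of [V] is a nonzero joint left eigenvector, on which the matrix value of a polynomial
    acts as its value at the eigenvalue point. *)
Lemma udiag_common_zero r (p : 'I_r -> mpoly.mpoly m C) (V : 'M[C]_n.+1)
    (d : 'I_m -> 'rV[C]_n.+1) i : V \is unitarymx ->
  (forall j, mxmeval (fun k => udiag V (d k)) (p j) = 0) ->
  common_zeros p (fun k => d k 0 i).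
Proof.
move=> uV p0 j; have v0 : row i V != 0.
  apply/eqP => v0; have /rowP/(_ i) := row_mul i V (V^t*).
  rewrite (unitarymxP uV) v0 mul0mx !mxE eqxx => /eqP.
  by rewrite oner_eq0.
have /eigen_mxmeval/(_ (p j)) : forall k,
    row i V *m udiag V (d k) = d k 0 i *: row i V.
  move=> k; rewrite -row_mul /udiag !mulmxA (unitarymxP uV) mul1mx row_mul.
  by rewrite row_diag_mx -scalemxAl -rowE.
rewrite p0 mulmx0 => /esym/eqP; rewrite scaler_eq0 (negPf v0) orbF.
by move/eqP.
Qed.

End MatrixEvaluation.

(** * An intertwiner close to the identity, uniformly in the dimension *)

Section SpectralIntertwiner.
Variables (R : realType) (m : nat).
Local Notation C := R[i].

Lemma eth_ge n (X Y : mxtuple R m n) j : opnorm (X j - Y j) <= eth X Y.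
Proof. exact: (le_bigmax_cond _ (fun j => opnorm (X j - Y j))). Qed.

Lemma eth_ge0 n (X Y : mxtuple R m n) : 0 <= eth X Y.
Proof. by apply: bigmax_ge_id. Qed.

(** Since the inverse of 0 is 0, coordinates where [w] and [z] agree contribute nothing, and the sum
    bounds the inverse gap in every other coordinate. *)
Definition gap_weight (w z : 'I_m -> C) : R :=
  \sum_j (Normc.normc (w j - z j))^-1.

Lemma gap_weight_ge0 w z : 0 <= gap_weight w z.
Proof. by rewrite sumr_ge0 // => j _; rewrite invr_ge0 normc_ge0. Qed.

(** The diagonal, in the eigenbasis, of the spectral projection onto the joint eigenspace of [z]. *)
Definition spectral_mask n (d : 'I_m -> 'rV[C]_n) (z : 'I_m -> C) : 'rV[C]_n :=
  \row_i (((fun j => d j 0 i) == z)%:R).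

Lemma opnorm_spectral_mask n (d : 'I_m -> 'rV[C]_n) z :
  opnorm (diag_mx (spectral_mask d z)) <= 1.
Proof.
apply: opnorm_diag => // i; rewrite mxE.
by case: eqP => _; rewrite ?Normc.normc1 ?Normc.normc0.
Qed.

Lemma mask_mul n (d : 'I_m -> 'rV[C]_n) z j :
  diag_mx (spectral_mask d z) *m diag_mx (d j) =
  z j *: diag_mx (spectral_mask d z).
Proof.
rewrite mulmx_diag -linearZ; congr diag_mx; apply/rowP => i; rewrite !mxE.
by case: eqP => [<-|_]; rewrite ?mulr1 ?mul1r ?mulr0 ?mul0r.
Qed.

(* E_w, F_z are spectral projections of commuting normal tuples: the (w, z)
   block solves a Sylvester equation, (w_j - z_j) E_w M F_z
   = E_w (Y_j M - M X_j) F_z. *)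
Lemma opnorm_block n (V W : 'M[C]_n) (d e : 'I_m -> 'rV[C]_n) w z :
  V \is unitarymx -> W \is unitarymx -> w != z ->
  opnorm (diag_mx (spectral_mask e w) *m (W *m V^t*)
            *m diag_mx (spectral_mask d z)) <=
  gap_weight w z * eth (fun j => udiag V (d j)) (fun j => udiag W (e j)).
Proof.
move=> uV uW wz; set E := diag_mx _; set F := diag_mx _; set M := W *m V^t*.
have [j wzj] : exists j, w j != z j.
  apply/not_existsP => h; case/eqP: wz; apply/funext => j; apply/eqP.
  by apply: contrapT => /negP; exact: h.
have key : (w j - z j) *: (E *m M *m F) =
    E *m (W *m (udiag W (e j) - udiag V (d j)) *m V^t*) *m F.
  rewrite (sylvester_udiag (d j) (e j) uV uW); apply: sylvester_block.
    exact: mask_mul.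
  by rewrite diag_mxC; exact: mask_mul.
have EF : E *m M *m F = (w j - z j)^-1 *:
    (E *m (W *m (udiag W (e j) - udiag V (d j)) *m V^t*) *m F).
  by rewrite -key scalerA mulVf ?subr_eq0 // scale1r.
rewrite EF; apply: le_trans (opnormZ_le _ _) _; rewrite Normc.normcV.
apply: ler_pM; rewrite ?invr_ge0 ?normc_ge0 ?opnorm_ge0 //.
  rewrite /gap_weight (bigD1 j) //= lerDl sumr_ge0 // => k _.
  by rewrite invr_ge0 normc_ge0.
apply: le_trans (opnormM _ _) _.
apply: le_trans (ler_piMr (opnorm_ge0 _) (opnorm_spectral_mask _ _)) _.
apply: le_trans (opnormM _ _) _.
apply: le_trans (ler_piMl (opnorm_ge0 _) (opnorm_spectral_mask _ _)) _.
have uV' := unitarymx_adj uV.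
apply: le_trans (opnorm_mul_unitary _ uV') _.
apply: le_trans (opnorm_unitary_mul _ uW) _.
rewrite opnormB.
exact: (eth_ge (fun j => udiag V (d j)) (fun j => udiag W (e j)) j).
Qed.

Lemma near_intertwiner n (V W : 'M[C]_n) (d e : 'I_m -> 'rV[C]_n)
    (s : seq ('I_m -> C)) (X := fun j => udiag V (d j))
    (Y := fun j => udiag W (e j)) :
  V \is unitarymx -> W \is unitarymx -> uniq s ->
  (forall i, (fun j => d j 0 i) \in s) -> (forall i, (fun j => e j 0 i) \in s) ->
  exists S : 'M[C]_n,
    [/\ forall j, S *m X j = Y j *m S,
        forall j, S *m (X j)^t* = (Y j)^t* *m S &
        opnorm (S - 1%:M) <=
        (\sum_(w <- s) \sum_(z <- s) gap_weight w z) * eth X Y].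
Proof.
move=> uV uW us ds es; pose M := W *m V^t*.
pose same i k := (fun j => e j 0 i) == (fun j => d j 0 k).
pose N : 'M[C]_n := \matrix_(i, k) (M i k *+ same i k).
have N0 i k : N i k != 0 -> same i k.
  by rewrite mxE; case: (same i k); rewrite ?mulr0n ?eqxx.
have same_eq j i k : same i k -> e j 0 i = d j 0 k.
  by move=> /eqP/(congr1 (fun f => f j)).
exists (W^t* *m N *m V); split=> [j|j|].
- by apply: (intertwine_udiag uV uW) => i k /N0; apply: same_eq.
- have [XE YE] := (udiag_adj V (d j), udiag_adj W (e j)).
  rewrite XE YE; apply: (intertwine_udiag uV uW) => i k /N0/(same_eq j).
  by rewrite !mxE => ->.
pose blk w z := diag_mx (spectral_mask e w) *m M *m diag_mx (spectral_mask d z).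
(* Each entry of [M] lies in exactly one block, that of its pair of joint eigenvalues, and [N]
   collects the blocks with [w = z]. The number of blocks depends on [s] alone, not on [n]. *)
have MN : M - N = \sum_(w <- s) \sum_(z <- s | w != z) blk w z.
  apply/matrixP => i k; rewrite summxE.
  pose ei : 'I_m -> C := fun j => e j 0 i.
  pose dk : 'I_m -> C := fun j => d j 0 k.
  have blkE w z : blk w z i k = M i k *+ ((ei == w) && (dk == z)).
    rewrite /blk mul_mx_diag mxE mul_diag_mx mxE !mxE -/ei -/dk.
    by do 2![case: eqP => _]; rewrite ?(mulr1, mul1r, mulr0, mul0r).
  rewrite (bigD1_seq ei (es i) us) /= 
   [X in _ = _ + X]big1_seq => [|w /andP[wi _]]; last first.
    by rewrite summxE big1 // => z _; rewrite blkE eq_sym (negPf wi).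
  rewrite addr0 summxE big_mkcond (bigD1_seq dk (ds k) us) /=.
  rewrite big1_seq => [|z /andP[zk _]].
    rewrite addr0 blkE !eqxx !mxE /same -/ei -/dk.
    by case: eqP => _; rewrite ?subrr ?subr0.
  by rewrite blkE [dk == _]eq_sym (negPf zk) andbF; case: ifP.
rewrite (intertwine_sub1 N uV uW) -/M.
apply: le_trans (opnorm_mul_unitary _ uV) _.
apply: le_trans (opnorm_unitary_mul _ _) _; first exact: unitarymx_adj.
rewrite opnormB MN mulr_suml; apply: le_trans (opnorm_sum _ _ _) _.
apply: ler_sum => w _; rewrite mulr_suml; apply: le_trans (opnorm_sum _ _ _) _.
(* The pairs with [w = z] are absent on the left and contribute nonnegative terms on the right. *)
rewrite big_mkcond; apply: ler_sum => z _; case: ifP => [wz|_].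
  exact: opnorm_block.
by rewrite mulr_ge0 ?gap_weight_ge0 ?eth_ge0.
Qed.

End SpectralIntertwiner.

(** * Unitary paths *)

Section Trigonometry.
Variable R : realType.
Implicit Types x y : R.

(** Both orders of [x] and [y] are covered. Locating [c] relative to [x] lets a Lipschitz bound on
    [df] become a quadratic remainder. *)
Lemma mvt_between (f df : R -> R) x y :
  (forall z : R, is_derive z (1 : R) f (df z)) ->
  exists2 c, `|c - x| <= `|y - x| & f y - f x = df c * (y - x).
Proof.
move=> fd; have fc : continuous f.
  by move=> z; apply/differentiable_continuous/derivable1_diffP; case: (fd z).
have fcw a b : {within `[a, b], continuous f} by exact: continuous_subspaceT.
have [xy|/ltW yx] := leP x y.
  have [c] := MVT_segment xy (fun z _ => fd z) (fcw x y).
  rewrite in_itv /= => /andP[xc cy] fE; exists c => //.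
  by rewrite !ger0_norm ?subr_ge0 // lerD2r.
have [c] := MVT_segment yx (fun z _ => fd z) (fcw y x).
rewrite in_itv /= => /andP[yc cx] fE; exists c.
  by rewrite !ler0_norm ?subr_le0 // lerN2 lerD2r.
by rewrite -opprB fE -mulrN opprB.
Qed.

Lemma sin_lipschitz x y : `|sin y - sin x| <= `|y - x|.
Proof.
have [c _ ->] := mvt_between x y (@is_derive_sin R).
by rewrite normrM ler_piMl // cos_max.
Qed.

Lemma cos_lipschitz x y : `|cos y - cos x| <= `|y - x|.
Proof.
have [c _ ->] := mvt_between x y (@is_derive_cos R).
by rewrite normrM ler_piMl // normrN sin_max.
Qed.

(** By the mean value theorem the remainder is [(cos c - cos x) * (y - x)], and cosine is
    1-Lipschitz. The cosine case is symmetric. *)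
Lemma sin_taylor1 x y : `|sin y - sin x - (y - x) * cos x| <= `|y - x| ^+ 2.
Proof.
have [c cx ->] := mvt_between x y (@is_derive_sin R).
rewrite [cos c * _]mulrC -mulrBr normrM expr2 ler_wpM2l //.
exact: le_trans (cos_lipschitz _ _) cx.
Qed.

Lemma cos_taylor1 x y : `|cos y - cos x + (y - x) * sin x| <= `|y - x| ^+ 2.
Proof.
have [c cx ->] := mvt_between x y (@is_derive_cos R).
rewrite [- sin c * _]mulrC mulrN addrC -mulrBr normrM expr2 ler_wpM2l //.
by rewrite distrC; exact: le_trans (sin_lipschitz _ _) cx.
Qed.

Definition cis x : R[i] := cos x +i* sin x.

Lemma cisD x y : cis (x + y) = cis x * cis y.
Proof.
by rewrite /cis cosD sinD; apply/eqP; rewrite eq_complex /= [sin x * _ + _]addrC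
  !eqxx.
Qed.

Lemma conj_cis x : Num.conj (cis x) = cis (- x).
Proof. by rewrite /cis cosN sinN. Qed.

Lemma cis0 : cis 0 = 1.
Proof. by rewrite /cis cos0 sin0. Qed.

Lemma normc_le (z : R[i]) : Normc.normc z <= `|complex.Re z| + `|complex.Im z|.
Proof.
case: z => a b /=; rewrite -ler_sqr ?nnegrE ?addr_ge0 ?sqrtr_ge0 //.
rewrite sqr_sqrtr ?addr_ge0 ?sqr_ge0 // sqrrD !real_normK ?num_real //.
by rewrite lerD2r lerDl mulrn_wge0 // mulr_ge0.
Qed.

Lemma cis_lipschitz x y : Normc.normc (cis y - cis x) <= 2 * `|y - x|.
Proof.
apply: le_trans (normc_le _) _; rewrite mulr_natl mulr2n /=.
by rewrite lerD ?cos_lipschitz ?sin_lipschitz.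
Qed.

Lemma cis_taylor1 x y :
  Normc.normc (cis y - cis x - (y - x)%:C * 'i * cis x) <= 2 * `|y - x| ^+ 2.
Proof.
apply: le_trans (normc_le _) _; rewrite mulr_natl mulr2n /=.
apply: lerD; [have := cos_taylor1 x y|have := sin_taylor1 x y];
  by congr (`|_| <= _); ring.
Qed.

(** The angle is the principal argument. Since |exp(ix) - 1|^2 = 2 - 2 cos x, and cosine is even and
    decreasing on [0, pi], shrinking the angle brings the point closer to 1. *)
Lemma cis_angle (u : R[i]) : Normc.normc u = 1 ->
  exists2 th, cis th = u & forall t, 0 <= t <= 1 ->
    Normc.normc (cis (t * th) - 1) <= Normc.normc (u - 1).
Proof.
case: u => a b u1; have ab1 : Num.sqrt (a ^+ 2 + b ^+ 2) = 1 := u1.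
have ab : a ^+ 2 + b ^+ 2 = 1.
  by rewrite -[LHS]sqr_sqrtr ?addr_ge0 ?sqr_ge0 // ab1 expr1n.
have a1 : -1 <= a <= 1.
  by rewrite -ler_norml -ler_sqr ?nnegrE // expr1n real_normK ?num_real // -ab
    lerDl sqr_ge0.
have [/andP[al0 alpi] cosal] := acos_def a1.
have sinal : sin (acos a) = `|b|.
  by rewrite sin_acos // -ab addrC addKr sqrtr_sqr.
have cis_sub1 x : Normc.normc (cis x - 1) = Num.sqrt (2 - 2 * cos x).
  rewrite /cis /=; congr Num.sqrt; rewrite subr0 sin2cos2; ring.
(* [acos a] lies in [0, pi]; the sign of [b] selects the half circle. *)
pose th := if 0 <= b then acos a else - acos a.
have thE : cis th = a +i* b.
  rewrite /th /cis; case: ifPn => [b0|]; first by rewrite cosal sinal ger0_norm.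
  by rewrite -ltNge => b0; rewrite cosN sinN cosal sinal ltr0_norm ?opprK.
exists th => // t /andP[t0 t1]; rewrite -thE !cis_sub1 ler_wsqrtr //.
rewrite lerD2l lerN2 ler_wpM2l //.
have cth : cos th = cos (acos a) by rewrite /th; case: ifP; rewrite ?cosN.
have -> : cos (t * th) = cos (t * acos a).
  by rewrite /th; case: ifP; rewrite ?mulrN ?cosN.
have ta : t * acos a <= acos a by rewrite ler_piMl.
by rewrite cth leNgt ltr_cos ?in_itv /= ?al0 ?mulr_ge0 ?(le_trans ta) // -leNgt.
Qed.

End Trigonometry.

(** * From quantitative bounds to piecewise smoothness *)

Section LinearBound.
Variables (R : realType) (m n : nat).
Local Notation C := R[i].
Implicit Types X Y : mxtuple R m n.

Lemma cvg0_linear_bound (F : set_system R) (FF : Filter F) (f : R -> R)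
    (t K : R) :
  F `=>` nbhs t -> (\forall s \near F, 0 <= f s <= K * `|s - t|) ->
  f s @[s --> F] --> (0 : R).
Proof.
move=> Ft fK; apply/cvgrPdist_lt => e e0.
(* [K] may be zero or negative, so |K| + 1 serves as a positive divisor. *)
have K0 : 0 < `|K| + 1 by rewrite ltr_wpDl.
have st : \forall s \near F, `|t - s| < e / (`|K| + 1).
  by apply: Ft; apply: nbhsx_ballx; rewrite divr_gt0.
near=> s; rewrite sub0r normrN.
have /andP[f0 fs] : 0 <= f s <= K * `|s - t| by near: s.
rewrite ger0_norm //; apply: le_lt_trans fs _.
apply: le_lt_trans (_ : (`|K| + 1) * `|s - t| < _).
  by rewrite ler_wpM2r // (le_trans (ler_norm K)) // lerDl.
by rewrite mulrC -ltr_pdivlMr // distrC; near: s.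
Unshelve. all: by end_near. Qed.

Lemma eth_le X Y (c : R) : 0 <= c ->
  (forall j, opnorm (X j - Y j) <= c) -> eth X Y <= c.
Proof. by move=> c0 h; apply: bigmax_le. Qed.

(** A quadratic Taylor remainder divided by |s - t| is linear in |s - t|, so differentiability and
    continuity reduce to the same squeeze. A single piece is enough. *)
Lemma smooth_piecewise_C1 (g dg : R -> mxtuple R m n) (K : R) : 0 <= K ->
  (forall j s t, opnorm (g s j - g t j) <= K * `|s - t|) ->
  (forall j s t, opnorm (dg s j - dg t j) <= K * `|s - t|) ->
  (forall j s t,
    opnorm (g s j - g t j - (s - t)%:C *: dg t j) <= K * `|s - t| ^+ 2) ->
  piecewise_C1 0 1 g.
Proof.
move=> K0 gK dgK gT.
have lip (h : R -> mxtuple R m n) (A : set R) :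
    (forall j s t, opnorm (h s j - h t j) <= K * `|s - t|) ->
    eth_continuous A h.
  move=> hK t At; apply: (@cvg0_linear_bound _ _ _ t K).
    exact: cvg_within.
  by apply: nearW => s; rewrite eth_ge0 eth_le ?mulr_ge0.
split; first exact: lip.
exists [:: 1]; first exact: itv_partition1.
move=> i _; exists dg; last exact: lip.
move=> t At; apply: (@cvg0_linear_bound _ _ _ t K).
  by move=> P tP; apply: cvg_within; apply: filterS tP.
rewrite near_withinE; near=> s => _.
have st : s - t != 0 by rewrite subr_eq0; near: s; exact: nbhs_dnbhs_neq.
rewrite eth_ge0 eth_le ?mulr_ge0 // => j.
have stC : (s - t)%:C != 0 :> C by rewrite -[0]/(0%:C) (inj_eq (@complexI R)).
have -> : ((s - t)^-1)%:C *: (g s j - g t j) - dg t j =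
    ((s - t)^-1)%:C *: (g s j - g t j - (s - t)%:C *: dg t j).
  by rewrite [RHS]scalerBr scalerA -rmorphM mulVf // scale1r.
apply: le_trans (opnormZ_le _ _) _; rewrite normc_real normfV.
by rewrite ler_pdivrMl ?normr_gt0 // mulrCA -expr2.
Unshelve. all: by end_near. Qed.

End LinearBound.

(** * Matrix paths with trigonometric entries *)

Section TrigonometricPath.
Variables (R : realType) (n : nat).
Local Notation C := R[i].
Implicit Types (V B : 'M[C]_n) (phi : 'I_n -> 'I_n -> R).

(** The form of a fixed matrix conjugated by a one-parameter unitary group, the frequencies
    [phi k l] being differences of angles. *)
Definition trig_mx V B phi (t : R) : 'M[C]_n :=
  V^t* *m (\matrix_(k, l) (B k l * cis (t * phi k l))) *m V.

(** The derivative in [t]. Its factor i phi is put into the coefficients, so the Lipschitz bound for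
    [trig_mx] applies to it too. *)
Definition dtrig_mx V B phi :=
  trig_mx V (\matrix_(k, l) (B k l * ((phi k l)%:C * 'i))) phi.

Lemma opnorm_conj_entry V (A : 'M[C]_n) (a : 'I_n -> 'I_n -> R) (c : R) :
  V \is unitarymx -> (forall k l, Normc.normc (A k l) <= a k l * c) ->
  opnorm (V^t* *m A *m V) <= (\sum_k \sum_l a k l) * c.
Proof.
move=> uV Aa; apply: le_trans (opnorm_mul_unitary _ uV) _.
apply: le_trans (opnorm_unitary_mul _ (unitarymx_adj uV)) _.
apply: le_trans (opnorm_entry _) _; rewrite mulr_suml ler_sum // => k _.
by rewrite mulr_suml ler_sum.
Qed.

Lemma trig_mx_lipschitz V B phi s t : V \is unitarymx ->
  opnorm (trig_mx V B phi s - trig_mx V B phi t) <=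
  (\sum_k \sum_l 2 * (Normc.normc (B k l) * `|phi k l|)) * `|s - t|.
Proof.
move=> uV; rewrite /trig_mx -mulmxBl -mulmxBr; apply: opnorm_conj_entry => // k l.
rewrite !mxE -mulrBr Normc.normcM.
have := cis_lipschitz (t * phi k l) (s * phi k l); rewrite -mulrBl normrM.
by move/(ler_wpM2l (normc_ge0 (B k l))) => h; apply: le_trans h _; lra.
Qed.

Lemma trig_mx_taylor1 V B phi s t : V \is unitarymx ->
  opnorm (trig_mx V B phi s - trig_mx V B phi t
          - (s - t)%:C *: dtrig_mx V B phi t) <=
  (\sum_k \sum_l 2 * (Normc.normc (B k l) * `|phi k l| ^+ 2)) * `|s - t| ^+ 2.
Proof.
move=> uV; rewrite /dtrig_mx /trig_mx scalemxAl scalemxAr -!mulmxBl -!mulmxBr.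
apply: opnorm_conj_entry => // k l; rewrite !mxE.
have -> : B k l * cis (s * phi k l) - B k l * cis (t * phi k l) -
    (s - t)%:C * (B k l * ((phi k l)%:C * 'i) * cis (t * phi k l)) =
  B k l * (cis (s * phi k l) - cis (t * phi k l) -
           (s * phi k l - t * phi k l)%:C * 'i * cis (t * phi k l)).
  by rewrite -[s * phi k l - _]mulrBl rmorphM /=; ring.
rewrite Normc.normcM.
have := cis_taylor1 (t * phi k l) (s * phi k l).
rewrite -[s * phi k l - _]mulrBl normrM.
by move/(ler_wpM2l (normc_ge0 (B k l))) => h; apply: le_trans h _; lra.
Qed.

End TrigonometricPath.

(** * Contracting a unitary to the identity through its angles *)

Section UnitaryPath.
Variables (R : realType) (n : nat).
Local Notation C := R[i].
Implicit Types (U V : 'M[C]_n).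

Lemma unitary_udiag_cis U : U \is unitarymx ->
  exists V (th : 'I_n -> R), [/\ V \is unitarymx,
    U = udiag V (\row_k cis (th k)) &
    forall t, 0 <= t <= 1 ->
      opnorm (udiag V (\row_k cis (t * th k)) - 1%:M) <= opnorm (U - 1%:M)].
Proof.
move=> uU; have nU : U \is normalmx.
  by apply/normalmxP; rewrite (unitarymxP uU) unitarymxKl.
have [V [d [uV UE]]] := normal_udiag nU.
move: (uU); rewrite UE => /(udiag_unitaryP d uV) d1.
have nd1 i : Normc.normc (d 0 i) = 1.
  apply/eqP; rewrite -sqrp_eq1 ?normc_ge0 //; apply/eqP/complexI.
  by rewrite sqr_normcE; exact: d1.
have /choice[th thE] : forall i, exists th : R, cis th = d 0 i /\
    forall t, 0 <= t <= 1 ->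
      Normc.normc (cis (t * th) - 1) <= Normc.normc (d 0 i - 1).
  by move=> i; have [th ? ?] := cis_angle (nd1 i); exists th.
exists V, th; split; first exact: uV.
  by congr udiag; apply/rowP => i; rewrite mxE (thE i).1.
move=> t t01; apply: (opnorm_udiag_sub1 uV (opnorm_ge0 _)) => i; rewrite mxE.
apply: le_trans ((thE i).2 t t01) _.
(* The eigenvalue of [U - 1%:M] is a diagonal entry in the eigenbasis, hence bounded by the operator
   norm. *)
have <- : (V *m (udiag V d - 1%:M) *m V^t*) i i = d 0 i - 1.
  rewrite -(udiag_const 1 uV) udiagB -udiagE //.
  by rewrite !mxE eqxx mulr1n.
by apply: le_trans (normc_le_opnorm _ _ _) _; exact: opnorm_conj.
Qed.

(** The left factor contributes the angle [t * th k] and the adjoint on the right the angle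
    [- (t * th l)]. *)
Lemma conj_udiag_cis V (A : 'M[C]_n) (th : 'I_n -> R) t
    (U := udiag V (\row_k cis (t * th k))) :
  U *m A *m U^t* =
  trig_mx V (V *m A *m V^t*) (fun k l => th k - th l) t.
Proof.
rewrite /U udiag_adj udiag_mul_mx; congr (_ *m _ *m _).
move: (V *m A *m V^t*) => B; apply/matrixP => k l; rewrite !mxE.
by rewrite mulrBr cisD -conj_cis mulrCA mulrA.
Qed.

Lemma trig_path_C1 m V (B : 'I_m -> 'M[C]_n) phi : V \is unitarymx ->
  piecewise_C1 0 1 (fun t j => trig_mx V (B j) phi t).
Proof.
move=> uV.
have /choice[K KP] : forall j, exists K, [/\ 0 <= K,
    forall s t, opnorm (trig_mx V (B j) phi s - trig_mx V (B j) phi t)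
                  <= K * `|s - t|,
    forall s t, opnorm (dtrig_mx V (B j) phi s - dtrig_mx V (B j) phi t)
                  <= K * `|s - t| &
    forall s t, opnorm (trig_mx V (B j) phi s - trig_mx V (B j) phi t
        - (s - t)%:C *: dtrig_mx V (B j) phi t) <= K * `|s - t| ^+ 2].
  move=> j; pose L A := \sum_k \sum_l 2 * (Normc.normc (A k l) * `|phi k l|) : R.
  pose K1 := L (B j).
  pose K2 := L (fun k l => B j k l * ((phi k l)%:C * 'i)).
  pose K3 := \sum_k \sum_l 2 * (Normc.normc (B j k l) * `|phi k l| ^+ 2).
  have L0 A : 0 <= L A.
    by do 2![rewrite sumr_ge0 // => ? _]; rewrite !mulr_ge0 ?normc_ge0.
  have K30 : 0 <= K3.
    by do 2![rewrite sumr_ge0 // => ? _]; rewrite !mulr_ge0 ?normc_ge0.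
  have [K10 K20] : 0 <= K1 /\ 0 <= K2 by split; apply: L0.
  exists (K1 + K2 + K3); split=> [|s t|s t|s t]; first by rewrite !addr_ge0.
  - apply: le_trans (trig_mx_lipschitz _ _ _ _ uV) _.
    by rewrite ler_wpM2r // -addrA lerDl addr_ge0.
  - apply: le_trans (trig_mx_lipschitz _ _ _ _ uV) _.
    apply: ler_wpM2r => //; apply: le_trans (_ : K2 <= _).
      by apply: ler_sum => k _; apply: ler_sum => l _; rewrite mxE.
    by rewrite addrAC lerDr addr_ge0.
  - apply: le_trans (trig_mx_taylor1 _ _ _ _ uV) _.
    by rewrite ler_wpM2r ?exprn_ge0 // lerDr addr_ge0.
(* Summing over the finitely many [j] gives one constant for the whole tuple. *)
have K0 : 0 <= \sum_j K j by rewrite sumr_ge0 // => j _; case: (KP j).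
have KS j : K j <= \sum_j K j.
  by rewrite (bigD1 j) //= lerDl sumr_ge0 // => k _; case: (KP k).
apply: (smooth_piecewise_C1 (dg := fun t j => dtrig_mx V (B j) phi t) K0)
  => j s t; have [_ h1 h2 h3] := KP j.
- by apply: le_trans (h1 s t) _; rewrite ler_wpM2r.
- by apply: le_trans (h2 s t) _; rewrite ler_wpM2r.
- by apply: le_trans (h3 s t) _; rewrite ler_wpM2r ?exprn_ge0.
Qed.

End UnitaryPath.

(** * Unitary invariance of the algebraic disk and the connecting path *)

Lemma algmxdisk_conj (R : realType) (m r n : nat)
    (p : 'I_r -> mpoly.mpoly m R[i]) (X : mxtuple R m n.+1)
    (U : 'M[R[i]]_n.+1) : U \is unitarymx ->
  algmxdisk n p X -> algmxdisk n p (fun j => U *m X j *m U^t*).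
Proof.
move=> uU [[Xc Xn X1] Xp]; split; last first.
  by move=> j; rewrite mxmeval_conj // Xp mulmx0 mul0mx.
split=> [j k|j|j].
- exact: comm_conjmx.
- exact: (normal_conjmx uU (Xn j)).
- exact: le_trans (opnorm_conj _ uU) (X1 j).
Qed.

Lemma algmxdisk_udiag (R : realType) (m r n : nat)
    (p : 'I_r -> mpoly.mpoly m R[i]) (X : mxtuple R m n.+1) :
  algmxdisk n p X -> exists V (d : 'I_m -> 'rV[R[i]]_n.+1),
    [/\ V \is unitarymx, X = (fun j => udiag V (d j)) &
        forall i, common_zeros p (fun j => d j 0 i)].
Proof.
move=> [[Xc Xn _] Xp]; have [V [d [uV XE]]] := simultaneous_udiag Xc Xn.
have {}XE : X = fun j => udiag V (d j) by apply/funext.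
exists V, d; split=> // i; move: Xp; rewrite XE.
exact: (udiag_common_zero i uV).
Qed.

Theorem theorem3p2 (R : realType) (m r : nat) (hm : (0 < m)%N) (hr : (0 < r)%N)
    (p : 'I_r -> mpoly.mpoly m R[i])
    (p_nonconst : forall j, ~ exists c : R[i], p j = mpoly.mpolyC m c)
    (p_finite : finite_set (common_zeros p)) :
  forall eps : R, 0 < eps ->
  exists2 delta : R, 0 < delta &
  forall (n : nat) (X Y : mxtuple R m n.+1),
    algmxdisk n p X ->
    (algmxdisk n p `&` eth_ball X delta) Y ->
  exists gamma : R -> mxtuple R m n.+1,
    [/\ piecewise_C1 0 1 gamma,
        gamma 0 = X,
        gamma 1 = Y &
        forall t : R, 0 <= t <= 1 ->
          algmxdisk n p (gamma t) /\ eth_ball X eps (gamma t)].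
Proof.
move=> eps eps0.
(* Duplicates are removed because the block decomposition must count each common zero once. *)
have /finite_seqP[s0 s0E] := p_finite; pose s := undup s0.
have inZ x : common_zeros p x -> x \in s.
  by rewrite s0E mem_undup.
pose K : R := \sum_(w <- s) \sum_(z <- s) gap_weight w z.
have K0 : 0 <= K.
  by do 2![rewrite sumr_ge0 // => ? _]; exact: gap_weight_ge0.
(* The polar step requires 1/2; eps / 9 keeps the final bound [8 * c] strictly below [eps]. *)
pose c : R := Num.min 2^-1 (eps / 9).
have c0 : 0 < c by rewrite lt_min !divr_gt0 // invr_gt0 ltr0n.
(* [K] vanishes when there is at most one common zero, hence the divisor [K + 1]. The dimension [n]
   is introduced only afterwards, which gives the uniformity. *)
exists (c / (K + 1)); first by rewrite divr_gt0 // ltr_wpDl.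
move=> n X Y XD [YD XY].
have [V [d [uV XE dZ]]] := algmxdisk_udiag XD.
have [W [e [uW YE eZ]]] := algmxdisk_udiag YD.
have [S [SX SXa S1]] := near_intertwiner uV uW (undup_uniq s0)
  (fun i => inZ _ (dZ i)) (fun i => inZ _ (eZ i)).
have {}S1 : opnorm (S - 1%:M) <= c.
  apply: le_trans S1 _; rewrite -XE -YE -/s -/K.
  apply: le_trans (_ : (K + 1) * (c / (K + 1)) <= _).
    by apply: ler_pM; rewrite ?eth_ge0 ?lerDl // ltW.
  by rewrite mulrC divfK // gt_eqF // ltr_wpDl.
have c2 : c <= 2^-1 by rewrite ge_min lexx.
have c9 : c <= eps / 9 by rewrite ge_min lexx orbT.
have [U [uU U1 UXY]] := unitary_intertwiner c2 S1 SX SXa.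
have [V' [th [uV' UE Uth]]] := unitary_udiag_cis uU.
pose Ut t := udiag V' (\row_k cis (t * th k)).
have uUt t : Ut t \is unitarymx.
  apply/(udiag_unitaryP _ uV') => i; rewrite mxE conj_cis -cisD.
  by rewrite addNr cis0.
exists (fun t j => Ut t *m X j *m (Ut t)^t*); split.
- rewrite (_ : (fun t j => _) = fun t j =>
      trig_mx V' (V' *m X j *m V'^t*) (fun k l => th k - th l) t).
    exact: trig_path_C1.
  by apply/funext => t; apply/funext => j; exact: conj_udiag_cis.
- have U0 : Ut 0 = 1%:M.
    rewrite -(udiag_const 1 uV'); congr udiag; apply/rowP => k.
    by rewrite !mxE mul0r cis0.
  apply/funext => j; rewrite U0 trmx1 map_mx1 mul1mx mulmx1 //.
- have U1E : Ut 1 = U.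
    by rewrite UE; congr udiag; apply/rowP => k; rewrite !mxE mul1r.
  by apply/funext => j; rewrite U1E {1}XE UXY YE.
move=> t t01; split; first exact: (algmxdisk_conj (uUt t) XD).
(* The factor 4 comes from the polar step, the factor 2 from the commutator bound for
   conjugation. *)
rewrite /eth_ball /=; apply: le_lt_trans (_ : 2 * (4 * c) < _); last first.
  by move: c9 eps0; move: (c); clear=> *; lra.
apply: eth_le => [|j]; first by rewrite !mulr_ge0 // ltW.
apply: le_trans (opnorm_conj_sub _ (uUt t)) _; rewrite ler_wpM2l //.
have [[_ _ X1] _] := XD.
(* The contraction bound on [X j] removes the dependence on [X]. *)
apply: le_trans (ler_piMr (opnorm_ge0 _) (X1 j)) _.
exact: le_trans (Uth t t01) U1.
Qed.
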